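(* Fix $k\geq 3$ and $\ell\geq 4$, and let $n\geq 10k^2\ell$. Then \[ \mathrm{sat}_k(n,\text{Berge-}K_\ell)\leq \frac{\ell-2}{k-1}\,n+\binom{\ell}{2}-1. \]
   Context: A hypergraph $\mathcal{H}$ is a Berge-$F$ (for a graph $F$) if $F$ and $\mathcal{H}$ can be embedded on a common vertex set with a bijection $\phi:E(F)\to E(\mathcal{H})$ such that $e\subseteq\phi(e)$ for every $e\in E(F)$; a hypergraph contains a Berge-$F$ if some subset of its edges forms one. A $k$-uniform hypergraph $\mathcal{H}$ is Berge-$F$-saturated if it contains no Berge-$F$, but $\mathcal{H}+e$ contains a Berge-$F$ for every $k$-set $e\subseteq V(\mathcal{H})$ with $e\notin E(\mathcal{H})$. $\mathrm{sat}_k(n,\text{Berge-}F)$ is the minimum number of edges in a Berge-$F$-saturated $k$-uniform hypergraph on $n$ vertices. *)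

(* Defs.v *)
From mathcomp Require Import all_boot.

Set Implicit Arguments.
Unset Strict Implicit.
Unset Printing Implicit Defensive.

(* A hypergraph on a finite vertex type is given by its set of edges; a graph
   is a 2-uniform hypergraph. *)
Definition uniform (V : finType) (k : nat) (H : {set {set V}}) : Prop :=
  forall e : {set V}, e \in H -> #|e| = k.

Definition complete_graph (l : nat) : {set {set 'I_l}} :=
  [set e : {set 'I_l} | #|e| == 2].

(* [W] is the common vertex set, into which [f] and [g] embed the vertices of
   [F] and of [H]; [phi] only matters on [F], where it is a bijection onto
   [H]. *)
Definition is_berge (T V : finType) (F : {set {set T}}) (H : {set {set V}})
    : Prop :=
  exists (W : finType) (f : T -> W) (g : V -> W) (phi : {set T} -> {set V}),
    [/\ injective f, injective g, {in F &, injective phi}, phi @: F = H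
      & forall e : {set T}, e \in F -> f @: e \subset g @: phi e].

Definition contains_berge (T V : finType) (F : {set {set T}})
    (H : {set {set V}}) : Prop :=
  exists2 S : {set {set V}}, S \subset H & is_berge F S.

Definition berge_saturated (T V : finType) (k : nat) (F : {set {set T}})
    (H : {set {set V}}) : Prop :=
  [/\ uniform k H,
      ~ contains_berge F H
    & forall e : {set V}, #|e| = k -> e \notin H -> contains_berge F (e |: H)].

(* [is_sat k n F m] states that sat_k(n, Berge-F) is defined and equal to [m].
   It is a relation because the minimum runs over an empty family for some
   [F], for instance when [F] has no edge. *)
Definition is_sat (T : finType) (k n : nat) (F : {set {set T}}) (m : nat)
    : Prop :=
  (exists2 H : {set {set 'I_n}}, berge_saturated k F H & #|H| = m) /\
  (forall H : {set {set 'I_n}}, berge_saturated k F H -> m <= #|H|).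

(* Main.v *)
Require Import Defs.
From mathcomp Require Import all_boot all_order all_algebra zify ring.
From Stdlib Require Import Classical.

Set Implicit Arguments.
Unset Strict Implicit.
Unset Printing Implicit Defensive.

(* Let C be a core of l - 2 vertices and cover the other vertices by blocks of
   size k - 1, each of which meets at most one other block. The hypergraph
   consists of all edges {c} + B (c in C, B a block), and of one edge
   {c, c'} + T for every pair of C, with a fixed (k-2)-subset T of a block B1.
   Berge-free: the vertices of a Berge-K_l outside C touch at most two blocks,
   so at most 2(l-2) + C(l-2, 2) = C(l, 2) - 1 edges contain two of its
   vertices.
   Saturated: a new edge meeting two distinct blocks B, B' in u, v completes
   C + {u, v}. Otherwise it contains a pair {c, c'} of C; take a block B2 that
   shares a point y with B1, and x in T distinct from y. The pair {x, y} is all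
   that C + {x, y} lacks, and it can be served by {c} + B1, then {c, x} by
   {c, c'} + T, and {c, c'} by the new edge. *)

(** * Berge cliques that lack one pair *)

Definition pairs (V : finType) (K : {set V}) : {set {set V}} :=
  [set q : {set V} | q \subset K & #|q| == 2].

(* [psi] assigns distinct edges of [H] to all pairs of [K] but [p], as in a
   Berge clique on [K] lacking only the pair [p]. *)
Definition near_clique (V : finType) (H : {set {set V}}) (K p : {set V})
    (psi : {set V} -> {set V}) : Prop :=
  [/\ p \in pairs K, {in pairs K :\ p &, injective psi}
    & forall q, q \in pairs K :\ p -> psi q \in H /\ q \subset psi q].

(** Rerouting: the edge of [q] also contains [p], so it can serve [p] instead. This leaves [q] as
    the only unserved pair and uses no new edge. *)
Lemma near_clique_swap (V : finType) (H : {set {set V}}) (K p q : {set V})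
    (psi : {set V} -> {set V}) :
  near_clique H K p psi -> q \in pairs K :\ p -> p \subset psi q ->
  near_clique H K q (fun r => if r == p then psi q else psi r).
Proof.
move=> [pK injpsi psiH] qKp pq; move: (qKp); rewrite !inE.
move=> /and3P[qp qK q2]; split; first by rewrite inE qK.
- move=> r s; rewrite in_setD1 [s \in _]in_setD1 => /andP[rq rK] /andP[sq sK].
  have [->|rp] := eqVneq r p; have [->|sp] := eqVneq s p => // E.
  + by case/eqP: sq; apply/esym/injpsi => //; rewrite in_setD1 sp.
  + by case/eqP: rq; apply/injpsi => //; rewrite in_setD1 rp.
  + by apply: injpsi => //; rewrite in_setD1 ?rp ?sp.
- move=> r; rewrite in_setD1 => /andP[rq rK].
  have [->|rp] := eqVneq r p; first by split=> //; case: (psiH q qKp).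
  by apply: psiH; rewrite in_setD1 rp.
Qed.

(** The edge [e] serves the missing pair, and it differs from all edges already assigned because it
    is not in [H]. *)
Lemma near_clique_contains_berge (V : finType) (l : nat) (H : {set {set V}})
    (K p e : {set V}) (psi : {set V} -> {set V}) :
  #|K| = l -> near_clique H K p psi -> p \subset e -> e \notin H ->
  contains_berge (complete_graph l) (e |: H).
Proof.
move=> Kl [pK injpsi psiH] pe eH.
pose f (i : 'I_l) := enum_val (cast_ord (esym Kl) i) : V.
have injf : injective f by move=> i j /enum_val_inj /cast_ord_inj.
pose phi (s : {set 'I_l}) := if f @: s == p then e else psi (f @: s).
have fK s : s \in complete_graph l -> f @: s \in pairs K.
  rewrite !inE (card_imset _ injf) => ->; rewrite andbT.
  by apply/subsetP => _ /imsetP[i _ ->]; apply: enum_valP.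
have fpsi s : s \in complete_graph l -> f @: s != p ->
    f @: s \in pairs K :\ p by move=> sl sp; rewrite in_setD1 sp fK.
exists (phi @: complete_graph l).
  apply/subsetP => _ /imsetP[s sl ->]; rewrite /phi in_setU1.
  case: (eqVneq (f @: s) p) => sp; first by rewrite eqxx.
  by case: (psiH _ (fpsi _ sl sp)) => ->; rewrite orbT.
exists V, f, id, phi; split=> //.
- move=> s t sl tl; rewrite /phi.
  case: (eqVneq (f @: s) p) => sp; case: (eqVneq (f @: t) p) => tp E.
  + by apply: (imset_inj injf); rewrite sp tp.
  + by case: (psiH _ (fpsi _ tl tp)); rewrite -E (negbTE eH).
  + by case: (psiH _ (fpsi _ sl sp)); rewrite E (negbTE eH).
  + by apply: (imset_inj injf); apply: injpsi => //; apply: fpsi.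
- move=> s sl; rewrite imset_id /phi.
  case: (eqVneq (f @: s) p) => [->//|sp].
  by case: (psiH _ (fpsi _ sl sp)).
Qed.

Lemma is_berge_embedding (V : finType) (l : nat) (S : {set {set V}}) :
  2 <= l -> is_berge (complete_graph l) S ->
  exists (h : 'I_l -> V) (phi : {set 'I_l} -> {set V}),
    [/\ injective h, {in complete_graph l &, injective phi},
        phi @: complete_graph l = S
      & forall e i, e \in complete_graph l -> i \in e -> h i \in phi e].
Proof.
move=> l2 [W [f [g [phi [injf injg injphi phiS sub]]]]].
have [h gh] : exists h : 'I_l -> V, forall i, f i = g (h i).
  apply: (@fin_all_exists _ (fun=> V) (fun i v => f i = g v)) => i.
  have [j ij] : exists j, j != i.
    have := cardsC1 i; rewrite card_ord => c.
    have /card_gt0P[j] : 0 < #|[set~ i]| by rewrite c; lia.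
    by rewrite !inE; exists j.
  have e2 : [set j; i] \in complete_graph l by rewrite inE cards2 ij.
  have /imsetP[v _ ->] := subsetP (sub _ e2) _ (imset_f f (set22 j i)).
  by exists v.
exists h, phi; split=> // [i j hij|e i el ie].
  by apply: injf; rewrite !gh hij.
have /imsetP[v ve] := subsetP (sub _ el) _ (imset_f f ie).
by rewrite gh => /injg ->.
Qed.

(** * Block systems and their edges *)

(** Blocks may overlap: [b] need not divide the number of vertices to cover, and saturation uses two
    blocks with a common point. [block_meet] keeps three distinct blocks from meeting pairwise, and
    a block from meeting two disjoint ones. *)
Record block_system (V : finType) (b : nat) (C : {set V})
    (BB : {set {set V}}) : Prop := BlockSystem {
  block_card : forall B, B \in BB -> #|B| = b;
  block_disjoint : forall B, B \in BB -> [disjoint B & C];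
  block_cover : forall v, v \notin C -> exists2 B, B \in BB & v \in B;
  block_meet : forall B B1 B2, B \in BB -> B1 \in BB -> B2 \in BB ->
    B1 != B -> B2 != B -> ~~ [disjoint B & B1] -> ~~ [disjoint B & B2] ->
    B1 = B2 }.

Definition star_edges (V : finType) (C : {set V}) (BB : {set {set V}}) :=
  [set c |: B | c in C, B in BB].

Definition core_edges (V : finType) (C T : {set V}) :=
  [set p :|: T | p in pairs C].

Lemma card_pairs (V : finType) (C : {set V}) : #|pairs C| = 'C(#|C|, 2).
Proof. by rewrite -cards_draws. Qed.

Lemma card_star_edges (V : finType) (C : {set V}) (BB : {set {set V}}) :
  #|star_edges C BB| <= #|C| * #|BB|.
Proof.
by rewrite /star_edges curry_imset2X -cardsX; apply: leq_imset_card.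
Qed.

Lemma card_core_edges (V : finType) (C T : {set V}) :
  #|core_edges C T| <= 'C(#|C|, 2).
Proof. by rewrite -card_pairs; apply: leq_imset_card. Qed.

(** With [c] core vertices, ['C(c, 2) + c * 2] bounds the number of core edges and star edges on two
    blocks: one less than a clique on [c.+2] vertices needs. *)
Lemma bin_addn2_2 c : 'C(c.+2, 2) = ('C(c, 2) + c * 2).+1.
Proof. by rewrite !binS bin0 !bin1; lia. Qed.

(** * Absence of a Berge clique *)

Lemma blocks_berge_free (V : finType) (b : nat) (C T B1 : {set V})
    (BB : {set {set V}}) :
  block_system b C BB -> B1 \in BB -> T \subset B1 ->
  ~ contains_berge (complete_graph #|C|.+2) (star_edges C BB :|: core_edges C T).
Proof.
move=> bs B1B TB1 [S SH /is_berge_embedding[//|h [phi [injh injphi phiS hphi]]]].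
have disj B v : B \in BB -> v \in B -> v \notin C.
  by move=> BBB vB; rewrite (disjointFr (block_disjoint bs BBB) vB).
have phiH e : e \in complete_graph #|C|.+2 ->
    phi e \in star_edges C BB :|: core_edges C T.
  by move=> el; apply: (subsetP SH); rewrite -phiS imset_f.
(* The edge serving a pair outside [C] is a star edge, whose block contains the pair, or a core
   edge, and then the pair lies in [T], hence in [B1]. *)
have common i j B : B \in BB -> h i \in B -> h j \notin C ->
    exists D, [/\ D \in BB, h i \in D & h j \in D].
  move=> BBB iB jC; have [<-|ij] := eqVneq i j; first by exists B.
  have el : [set i; j] \in complete_graph #|C|.+2 by rewrite inE cards2 ij.
  have ie := @hphi _ _ el (set21 i j); have je := @hphi _ _ el (set22 i j).
  have iC := disj _ _ BBB iB.
  have := phiH _ el; rewrite in_setU => /orP[/imset2P[c D cC DB E]|].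
    exists D; move: ie je; rewrite E !in_setU1.
    by case: eqP iC => [->|_ _]; case: eqP jC => [->|_ _]; rewrite ?cC.
  case/imsetP=> q; rewrite inE => /andP[qC _] E; exists B1.
  move: ie je; rewrite E !in_setU.
  case/orP=> [/(subsetP qC)|/(subsetP TB1) ->]; first by rewrite (negbTE iC).
  by case/orP=> [/(subsetP qC)|/(subsetP TB1) ->]; first by rewrite (negbTE jC).
(* If the two blocks were disjoint, the block through both vertices would be a third one meeting
   each of them. *)
have meet i j B B' : B \in BB -> B' \in BB -> h i \in B -> h j \in B' ->
    B != B' -> ~~ [disjoint B & B'].
  move=> BBB BBB' iB jB' nBB'.
  have [D [DB iD jD]] := @common i j B BBB iB (disj _ _ BBB' jB').
  apply/negP => dBB'.
  have DB' : D != B.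
    by apply: contraTneq jD => ->; rewrite (disjointFl dBB').
  have DB'' : D != B'.
    by apply: contraTneq iD => ->; rewrite (disjointFr dBB').
  case/eqP: nBB'; apply: (@block_meet _ _ _ _ bs D) => //; rewrite 1?eq_sym //.
    by apply/pred0Pn; exists (h i); rewrite /= iD.
  by apply/pred0Pn; exists (h j); rewrite /= jD.
(* The blocks touched by the clique meet pairwise, so there are at most two. *)
pose BK := [set B in BB | [exists i, h i \in B]].
have BK2 : #|BK| <= 2.
  rewrite leqNgt; apply/negP => /card_gt2P[B [B' [B'' [[]]]]].
  rewrite !inE => /andP[HB /existsP[i iB]] /andP[HB' /existsP[j jB]].
  move=> /andP[HB'' /existsP[m mB]] [n1 n2 n3].
  case/eqP: n2; apply: (@block_meet _ _ _ _ bs B) => //; rewrite 1?eq_sym //.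
    exact: (@meet i j).
  by rewrite eq_sym in n3; apply: (@meet i m).
(* A star edge used by the clique contains two clique vertices, at most one of which is its core
   vertex [c]; the other one lies in its block. *)
have : S \subset core_edges C T :|: star_edges C BK.
  rewrite -phiS; apply/subsetP => _ /imsetP[e el ->].
  have := phiH _ el; rewrite setUC !in_setU; case/orP => [->//|].
  case/imset2P => c B cC BBB E; apply/orP; right; rewrite E.
  apply: imset2_f => //; rewrite inE BBB /=; apply/existsP.
  have : #|e| == 2 by move: el; rewrite inE.
  move=> /cards2P[i [j [ij Eij]]].
  have [ie je] : i \in e /\ j \in e by rewrite Eij set21 set22.
  move: (@hphi _ _ el ie) (@hphi _ _ el je); rewrite E !in_setU1.
  case/orP => [/eqP ic|]; last by exists i.
  by case/orP => [/eqP jc|]; [case/eqP: ij; apply: injh; rewrite ic jc|exists j].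
move/subset_leq_card; rewrite -phiS (card_in_imset injphi).
rewrite card_draws card_ord bin_addn2_2; apply/negP; rewrite -leqNgt.
rewrite (leq_trans (leq_card_setU _ _)) // leq_add ?card_core_edges //.
by rewrite (leq_trans (card_star_edges _ _)) // leq_mul.
Qed.

(** * Saturation *)

(** Star edges on [B] serve the pairs at [u], star edges on [B'] those at [v], and core edges the
    pairs inside [C]. The trace of such an edge on [C] and its part outside [C] together determine
    the pair. *)
Lemma blocks_near_clique (V : finType) (b : nat) (C T B B' : {set V})
    (BB : {set {set V}}) (u v : V) :
  block_system b C BB -> [disjoint T & C] ->
  B \in BB -> B' \in BB -> B != B' -> u \in B -> v \in B' -> u != v ->
  near_clique (star_edges C BB :|: core_edges C T) (u |: (v |: C)) [set u; v]
    (fun p => p :|: (if u \in p then B else if v \in p then B' else T)).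
Proof.
move=> bs TC BBB BBB' nBB' uB vB' uv.
have BC := block_disjoint bs BBB; have BC' := block_disjoint bs BBB'.
have uC : u \notin C by rewrite (disjointFr BC uB).
have vC : v \notin C by rewrite (disjointFr BC' vB').
set psi := fun p : {set V} => _; set K := u |: (v |: C).
have shape p : p \in pairs K :\ [set u; v] ->
  [\/ exists2 c, c \in C & p = [set c; u], exists2 c, c \in C & p = [set c; v]
    | p \in pairs C].
  rewrite in_setD1 => /andP[puv]; rewrite inE => /andP[pK /cards2P[i [j [ij pij]]]].
  have : i \in K /\ j \in K by split; apply: (subsetP pK); rewrite pij ?set21 ?set22.
  rewrite !in_setU1 => -[].
  move: ij puv; rewrite pij => ij puv.
  case/or3P => [/eqP iE|/eqP iE|iC]; case/or3P => [/eqP jE|/eqP jE|jC].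
  - by rewrite iE jE eqxx in ij.
  - by rewrite iE jE eqxx in puv.
  - by constructor 1; exists j; rewrite // iE setUC.
  - by rewrite iE jE setUC eqxx in puv.
  - by rewrite iE jE eqxx in ij.
  - by constructor 2; exists j; rewrite // iE setUC.
  - by constructor 1; exists i; rewrite // jE.
  - by constructor 2; exists i; rewrite // jE.
  - constructor 3; rewrite inE cards2 ij eqxx andbT.
    by apply/subsetP => z; rewrite !inE => /orP[]/eqP->.
have psiU c : c \in C -> psi [set c; u] = c |: B.
  move=> cC; rewrite /psi set22; apply/setP => z; rewrite !inE.
  by case: (eqVneq z u) => [->|]; rewrite ?uB ?orbT ?orbF.
have psiV c : c \in C -> psi [set c; v] = c |: B'.
  move=> cC; rewrite /psi set22 !inE (negbTE uv) orbF.
  have -> : (u == c) = false by apply: contraNF uC => /eqP->.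
  apply/setP => z; rewrite !inE.
  by case: (eqVneq z v) => [->|]; rewrite ?vB' ?orbT ?orbF.
have psiC p : p \in pairs C -> psi p = p :|: T.
  rewrite inE => /andP[/subsetP pC _]; rewrite /psi.
  rewrite ifN; last by apply: contra uC => /pC.
  by rewrite ifN //; apply: contra vC => /pC.
have traceC (A D : {set V}) :
    A \subset C -> [disjoint D & C] -> (A :|: D) :&: C = A.
  move=> AC; rewrite -setI_eq0 => /eqP DC.
  by rewrite setIUl DC setU0; apply/setIidPl.
have restC (A D : {set V}) :
    A \subset C -> [disjoint D & C] -> (A :|: D) :\: C = D.
  move=> AC DC; rewrite setDUl (setDidPl DC).
  by move: AC; rewrite -setD_eq0 => /eqP->; rewrite set0U.
have s1 c : c \in C -> [set c] \subset C by rewrite sub1set.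
have s2 p : p \in pairs C -> p \subset C by rewrite inE => /andP[].
have n12 c p : p \in pairs C -> [set c] != p.
  by rewrite inE => /andP[_ p2]; apply: contraTneq p2 => <-; rewrite cards1.
split.
- rewrite inE cards2 uv andbT; apply/subsetP => z; rewrite !inE.
  by case/orP => ->; rewrite ?orbT.
- move=> p q /shape pS /shape qS E.
  have EC := congr1 (fun A => A :&: C) E; have ED := congr1 (fun A => A :\: C) E.
  case: pS EC ED => [[c cC ->]|[c cC ->]|pC];
    case: qS => [[d dC ->]|[d dC ->]|qC];
    rewrite ?psiU ?psiV ?psiC // !traceC ?s1 ?s2 // !restC ?s1 ?s2 //.
  + by move/set1_inj->.
  + by move=> _ /eqP; rewrite (negbTE nBB').
  + by move/eqP; rewrite (negbTE (n12 _ _ _)).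
  + by move=> _ /esym/eqP; rewrite (negbTE nBB').
  + by move/set1_inj->.
  + by move/eqP; rewrite (negbTE (n12 _ _ _)).
  + by move/esym/eqP; rewrite (negbTE (n12 _ _ _)).
  + by move/esym/eqP; rewrite (negbTE (n12 _ _ _)).
- move=> p /shape[[c cC ->]|[c cC ->]|pC].
  + rewrite psiU //; split; last by rewrite subUset !sub1set !inE eqxx uB orbT.
    by rewrite inE; apply/orP; left; apply: imset2_f.
  + rewrite psiV //; split; last by rewrite subUset !sub1set !inE eqxx vB' orbT.
    by rewrite inE; apply/orP; left; apply: imset2_f.
  + rewrite psiC //; split; last exact: subsetUl.
    by rewrite inE; apply/orP; right; apply: imset_f.
Qed.

Lemma blocks_saturated (V : finType) (b : nat) (C T B1 B2 : {set V})
    (BB : {set {set V}}) (x y : V) :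
  block_system b C BB -> 1 < b -> B1 \in BB -> B2 \in BB -> B1 != B2 ->
  x \in B1 -> y \in B1 -> y \in B2 -> x != y -> x \in T -> [disjoint T & C] ->
  forall e : {set V}, #|e| = b.+1 -> e \notin star_edges C BB :|: core_edges C T ->
  contains_berge (complete_graph #|C|.+2)
    (e |: (star_edges C BB :|: core_edges C T)).
Proof.
move=> bs b1 B1B B2B nB12 xB1 yB1 yB2 xy xT TC e eb eH.
have card_core u v : u \notin C -> v \notin C -> u != v ->
    #|u |: (v |: C)| = #|C|.+2.
  by move=> uC vC uv; rewrite !cardsU1 in_setU1 (negbTE uv) uC vC.
have disj B v : B \in BB -> v \in B -> v \notin C.
  by move=> BBB vB; rewrite (disjointFr (block_disjoint bs BBB) vB).
have [/card_gt1P[c [c' [ce c'e cc']]]|eC] := boolP (1 < #|e :&: C|).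
  move: ce c'e; rewrite !inE => /andP[ce cC] /andP[c'e c'C].
  have xC := disj _ _ B1B xB1; have yC := disj _ _ B2B yB2.
  have cx : c != x by apply: contraNneq xC => <-.
  have cy : c != y by apply: contraNneq yC => <-.
  have c'x : c' != x by apply: contraNneq xC => <-.
  have c'y : c' != y by apply: contraNneq yC => <-.
  have := blocks_near_clique bs TC B1B B2B nB12 xB1 yB2 xy.
  set psi := (fun p : {set V} => _); set K := x |: (y |: C) => N0.
  (* Two swaps move the missing pair from [[set x; y]] to [[set c; x]] and then to [[set c; c']],
     which [e] contains. *)
  have cx_pair : [set c; x] \in pairs K :\ [set x; y].
    rewrite in_setD1 inE cards2 cx !subUset !sub1set !inE cC eqxx !orbT !andbT.
    by apply/eqP => /setP/(_ c); rewrite !inE eqxx (negbTE cx) (negbTE cy).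
  have cc'_pair : [set c; c'] \in pairs K :\ [set c; x].
    rewrite in_setD1 inE cards2 cc' !subUset !sub1set !inE cC c'C !orbT !andbT.
    apply/eqP => /setP/(_ c'); rewrite !inE eqxx orbT.
    by rewrite eq_sym (negbTE cc') (negbTE c'x).
  have N1 := near_clique_swap N0 cx_pair.
  have /N1 {}N1 : [set x; y] \subset psi [set c; x].
    by rewrite /psi set22 subUset !sub1set !inE xB1 yB1 !orbT.
  have /(near_clique_swap N1 cc'_pair) N2 :
      [set c; x] \subset (if [set c; c'] == [set x; y] then psi [set c; x]
                          else psi [set c; c']).
    rewrite ifN; last first.
      by apply/eqP => /setP/(_ c); rewrite !inE eqxx (negbTE cx) (negbTE cy).
    rewrite /psi !inE ![_ == c]eq_sym ![_ == c']eq_sym.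
    rewrite (negbTE cx) (negbTE c'x) (negbTE cy) (negbTE c'y) /=.
    by rewrite subUset !sub1set !inE eqxx xT !orbT.
  apply: (near_clique_contains_berge _ N2) => //.
    by rewrite card_core.
  by rewrite subUset !sub1set ce.
have [u [v [B [B' [ue ve BBB BBB' [uB vB' uv nBB']]]]]] :
    exists u v B B', [/\ u \in e, v \in e, B \in BB, B' \in BB
      & [/\ u \in B, v \in B', u != v & B != B']].
  (* Here [e] has at most one vertex in [C]. If its other vertices all lay in one block, they would
     fill it and [e] would be a star edge. *)
  have eC_card : b <= #|e :\: C| by have := cardsID C e; lia.
  have /card_gt0P[u] : 0 < #|e :\: C| by lia.
  rewrite inE => /andP[uC ue]; have [B BBB uB] := block_cover bs uC.
  have [sub|/subsetPn[v]] := boolP (e :\: C \subset B); last first.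
    rewrite inE => /andP[vC ve] vB; have [B' BBB' vB'] := block_cover bs vC.
    exists u, v, B, B'; do 2!split=> //.
      by apply: contraNneq vB => <-.
    by apply: contraNneq vB => ->.
  have EB : e :\: C = B.
    by apply/eqP; rewrite eqEcard sub (block_card bs BBB).
  have /cards1P[c Ec] : #|e :&: C| == 1.
    by have := cardsID C e; rewrite EB (block_card bs BBB); lia.
  case/negP: eH; rewrite inE; apply/orP; left.
  rewrite -(setID e C) EB Ec; apply: imset2_f => //.
  by have := set11 c; rewrite -Ec inE => /andP[].
apply: (near_clique_contains_berge _
  (blocks_near_clique bs TC BBB BBB' nBB' uB vB' uv)) => //.
  by rewrite card_core ?(disj _ _ BBB uB) ?(disj _ _ BBB' vB').
by rewrite subUset !sub1set ue.
Qed.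

Lemma blocks_uniform (V : finType) (b : nat) (C T : {set V})
    (BB : {set {set V}}) :
  block_system b C BB -> [disjoint T & C] -> #|T|.+1 = b ->
  uniform b.+1 (star_edges C BB :|: core_edges C T).
Proof.
move=> bs TC Tb e; rewrite in_setU => /orP[/imset2P[c B cC BBB ->]|].
  by rewrite cardsU1 (block_card bs BBB) (disjointFl (block_disjoint bs BBB) cC).
case/imsetP=> p; rewrite inE => /andP[pC /eqP p2] ->.
rewrite cardsU p2 -Tb (_ : p :&: T = set0) ?cards0; first by lia.
apply/eqP; rewrite setI_eq0 disjoint_sym.
exact: disjointWr pC TC.
Qed.

(** * Existence of the saturation number *)

(** Descent on the number of edges; the case split is classical because saturation is stated in
    [Prop]. *)
Lemma saturated_is_sat (T : finType) (k n : nat) (F : {set {set T}})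
    (H : {set {set 'I_n}}) :
  berge_saturated k F H -> exists2 m, is_sat k n F m & m <= #|H|.
Proof.
move Em: #|H| => m; elim/ltn_ind: m H Em => m IH H Hm satH.
have [mn|] := classic (forall H' : {set {set 'I_n}},
  berge_saturated k F H' -> m <= #|H'|).
  by exists m; [split=> //; exists H|].
move=> nmin; have [H' nH'] := not_all_ex_not _ _ nmin.
have [satH' /negP] := imply_to_and _ _ nH'; rewrite -ltnNge => lt.
have [m' sat le] := IH _ lt H' erefl satH'.
by exists m' => //; apply: leq_trans le (ltnW lt).
Qed.

(** * A block system made of intervals *)

Lemma card_interval (n a d : nat) :
  a + d <= n -> #|[set i : 'I_n | a <= i < a + d]| = d.
Proof.
move=> adn; have lt (j : 'I_d) : a + j < n by have := ltn_ord j; lia.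
rewrite -[RHS]card_ord -(card_imset _ (_ : injective (fun j => Ordinal (lt j)))).
  apply: eq_card => i; rewrite inE; apply/idP/imsetP => [ia|[j _ ->] /=]; last first.
    by have := ltn_ord j; lia.
  have id : i - a < d by lia.
  by exists (Ordinal id) => //; apply: val_inj => /=; lia.
by move=> j j' /(congr1 val) /= /addnI /val_inj.
Qed.

(* Truncated subtraction makes the first two starts [0] and [b.-1], so that
   the first two blocks share exactly one point; the last block is pushed back
   to end at [N]. *)
Definition block_start (b N j : nat) : nat := minn (j * b - 1) (N - b).

(** The starts [j * b - 1] with [0 < j < N %/ b] are spaced by [b], so their blocks are disjoint.
    Truncation moves block [0] right by one point, and the last block moves left by less than [b],
    so it reaches only its predecessor. *)
Lemma block_start_close (b N j j' : nat) :
  0 < b -> 3 * b <= N -> j < j' <= N %/ b ->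
  block_start b N j' < block_start b N j + b ->
  (j = 0 /\ j' = 1) \/ (j'= j.+1 /\ j' = N %/ b).
Proof.
rewrite /block_start => b0 bN; set q := N %/ b => jj'.
have q1 : q * b <= N by apply: leq_trunc_div.
have q2 : N < q * b + b by have := ltn_ceil N b0; rewrite -/q mulSn; lia.
have [j'q|j'q] := ltnP j' q.
  have h1 : j' * b + b <= q * b by rewrite addnC -mulSn leq_mul2r j'q orbT.
  have [->|j0] := posnP j.
    have [->|j'1] := eqVneq j' 1; first by left.
    have : 2 * b <= j' * b by rewrite leq_mul2r; lia.
    lia.
  have h2 : j * b + b <= j' * b by rewrite addnC -mulSn leq_mul2r; lia.
  have h3 : b <= j * b by rewrite leq_pmull.
  lia.
have -> : j' = q by lia.
have [->|jq] := eqVneq j.+1 q; first by right.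
have h2 : j.+2 * b <= q * b by rewrite leq_mul2r; lia.
rewrite !mulSn in h2.
lia.
Qed.

Lemma interval_blocks (n c b : nat) :
  1 < b -> c + 3 * b <= n ->
  exists (C : {set 'I_n}) (BB : {set {set 'I_n}}) (B1 B2 : {set 'I_n})
    (x y : 'I_n),
    [/\ #|C| = c, block_system b C BB, #|BB| * b <= n - c + b,
        [/\ B1 \in BB, B2 \in BB & B1 != B2]
      & [/\ x \in B1, y \in B1, y \in B2 & x != y]].
Proof.
move=> b1 cbn; set N := n - c.
pose B j : {set 'I_n} :=
  [set i : 'I_n | c + block_start b N j <= i < c + block_start b N j + b].
pose m := (N %/ b).+1.
have b0 : 0 < b by lia.
have bN : 3 * b <= N by lia.
(* This keeps the overlapping index pairs [0, 1] and [N %/ b - 1, N %/ b] apart, as [block_meet]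
   requires. *)
have q3 : 3 <= N %/ b by rewrite leq_divRL.
have BP j (jm : j < m) : B j \in [set B i | i : 'I_m].
  by apply/imsetP; exists (Ordinal jm).
have n0 : c < n by lia.
have n1 : c + (b - 1) < n by lia.
(* The core comes first. The points [x] and [y] are the first and the last point of [B 0], and [y]
   is also the first point of [B 1]. *)
exists [set i : 'I_n | i < c], [set B j | j : 'I_m], (B 0), (B 1),
  (Ordinal n0), (Ordinal n1).
have s0 : block_start b N 0 = 0 by rewrite /block_start; lia.
have s1 : block_start b N 1 = b - 1 by rewrite /block_start; lia.
split.
- apply: etrans (@card_interval n 0 c _); last by lia.
  by apply: eq_card => i; rewrite !inE.
- split.
  + move=> _ /imsetP[j _ ->]; apply: card_interval.
    by rewrite /block_start; lia.
  + move=> _ /imsetP[j _ ->]; apply/pred0P => i /=; rewrite !inE.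
    by apply/negbTE; lia.
  + move=> v; rewrite inE -leqNgt => cv; have vn := ltn_ord v.
    have [h|h] := leqP (N - b) (v - c).
      exists (B (N %/ b)); first exact: BP.
      rewrite inE /block_start.
      have := ltn_ceil N b0; rewrite mulSn; lia.
    (* The successor compensates for the [- 1] in the starts. *)
    exists (B ((v - c).+1 %/ b)).
      by apply: BP; rewrite ltnS leq_div2r //; lia.
    rewrite inE /block_start.
    have := ltn_ceil (v - c).+1 b0; have := leq_trunc_div (v - c).+1 b.
    by rewrite mulSn; lia.
  + move=> _ _ _ /imsetP[j _ ->] /imsetP[j1 _ ->] /imsetP[j2 _ ->].
    have jj (i i' : 'I_m) : i < i' -> ~~ [disjoint B i & B i'] ->
        (i = 0 :> nat /\ i' = 1 :> nat) \/ (i' = i.+1 :> nat /\ i' = N %/ b :> nat).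
      move=> ii' /pred0Pn[v /=]; rewrite !inE => vB; apply: block_start_close => //.
        by rewrite ii' -ltnS ltn_ord.
      by lia.
    move=> n1j n2j d1 d2.
    have {}n1j : j1 != j :> nat by apply: contraNneq n1j => ->.
    have {}n2j : j2 != j :> nat by apply: contraNneq n2j => ->.
    suff -> : j1 = j2 by [].
    have e1 := jj j j1; have e1' := jj j1 j; have e2 := jj j j2; have e2' := jj j2 j.
    rewrite d1 in e1; rewrite d2 in e2; rewrite disjoint_sym d1 in e1'.
    rewrite disjoint_sym d2 in e2'; apply: val_inj => /=.
    case: (ltngtP j1 j) n1j e1 e1' => // h1 _ e1 e1';
    case: (ltngtP j2 j) n2j e2 e2' => // h2 _ e2 e2'.
    * by case: (e1' isT isT); case: (e2' isT isT); lia.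
    * by case: (e1' isT isT); case: (e2 isT isT); lia.
    * by case: (e1 isT isT); case: (e2' isT isT); lia.
    * by case: (e1 isT isT); case: (e2 isT isT); lia.
- have : #|[set B j | j : 'I_m]| <= m.
    by rewrite -[m in _ <= m]card_ord leq_imset_card.
  have := leq_trunc_div N b; rewrite /m => h1 h2.
  by rewrite (leq_trans (leq_mul h2 (leqnn b))) // mulSn addnC leq_add2r.
- split; [by apply: BP|by apply: BP; lia|].
  apply/eqP => /setP/(_ (Ordinal n0)); rewrite !inE /= s0 s1; lia.
- rewrite !inE /= s0 s1; split; try lia.
  by apply/eqP => /(congr1 val) /=; lia.
Qed.

(** * The numerical bound *)

Import GRing.Theory Num.Theory.
Local Open Scope ring_scope.

Theorem theorem3p9 (k l n : nat) (hk : (3 <= k)%N) (hl : (4 <= l)%N)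
    (hn : (10 * k ^ 2 * l <= n)%N) :
  exists2 m : nat, is_sat k n (complete_graph l) m
    & (m%:R : rat) <= (l%:R - 2) / (k%:R - 1) * n%:R + 'C(l, 2)%:R - 1.
Proof.
(* The core size is [c = l - 2] and the block size is [b = k - 1]. *)
case: l hl hn => [|[|c]] //; case: k hk => [|b] // hb hc hn.
have b1 : (1 < b)%N by [].
have cbn : (c + 3 * b <= n)%N by nia.
have [C [BB [B1 [B2 [x [y]]]]]] := interval_blocks b1 cbn.
move=> [Cc bs cardBB [B1B B2B nB12] [xB1 yB1 yB2 xy]].
(* The set [B1 :\ y] serves as [T]: it has [k - 2] points and contains [x]. *)
have TC : [disjoint B1 :\ y & C].
  exact: disjointWl (subsetDl _ _) (block_disjoint bs B1B).
have Tb : #|B1 :\ y|.+1 = b by rewrite -(block_card bs B1B) [RHS](cardsD1 y) yB1.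
have xT : x \in B1 :\ y by rewrite !inE xy.
have := @saturated_is_sat _ b.+1 n (complete_graph c.+2)
  (star_edges C BB :|: core_edges C (B1 :\ y)).
case.
  split; first exact: blocks_uniform.
    by rewrite -Cc; apply: (blocks_berge_free bs B1B); apply: subsetDl.
  by rewrite -Cc; exact: (blocks_saturated bs b1 B1B B2B nB12 xB1 yB1 yB2 xy).
move=> m sat mH; exists m => //.
have {mH} mle : (m <= c * #|BB| + 'C(c, 2))%N.
  apply: leq_trans mH _; rewrite (leq_trans (leq_card_setU _ _)) // -Cc.
  by rewrite leq_add ?card_star_edges ?card_core_edges.
(* Multiplying by [b] keeps the bound in [nat]. The surplus [b] in [cardBB] costs at most [c] edges,
   which the term [c * 2] absorbs. *)
have mb : (m * b <= c * n + ('C(c, 2) + c * 2) * b)%N.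
  have h : (c * (#|BB| * b) <= c * (n + b))%N by rewrite leq_mul2l; lia.
  by apply: leq_trans (leq_mul mle (leqnn b)) _; rewrite mulnDl -mulnA; lia.
have b0 : (0 : rat) < b%:R by rewrite ltr0n; lia.
have -> : (c.+2%:R - 2) / (b.+1%:R - 1) * n%:R + 'C(c.+2, 2)%:R - 1 =
    (c * n + ('C(c, 2) + c * 2) * b)%:R / b%:R :> rat.
  rewrite bin_addn2_2 -[c.+2]addn2 -[b.+1]addn1 -[(_ + c * 2).+1]addn1.
  rewrite !natrD !natrM !natrD !natrM !addrK.
  by field; apply: lt0r_neq0.
by rewrite ler_pdivlMr // -natrM ler_nat.
Qed.
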